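(* Let $\mathcal{V}$ be a family of closed subsets of $\mathbb{R}^d$ and let $\mathcal{U}$ be the family of their complements. Let $X$ be a random variable with values in $\mathbb{R}^d$ and distribution $P$. Assume that: for every $x\in\mathbb{R}^d$ there is a $U\in\mathcal{U}$ with $x\in U$; $D(x;P,\mathcal{U})>0$ for at least one $x\in\mathbb{R}^d$; and $\lim_{\|x\|\to+\infty}D(x;P,\mathcal{U})=0$. Let $\alpha_m$ be the maximum of the depth function $D(x;P,\mathcal{U})$ over $x\in\mathbb{R}^d$, which is achieved at all points of the center $C(P,\mathcal{U})$, and let $f:\mathbb{R}^d\to\mathbb{R}$ be a C-function with respect to $\mathcal{V}$. Then for every $m\in C(P,\mathcal{U})$, $$f(m)\le Q_{1-\alpha_m},$$ where $Q_{1-\alpha_m}$ is the largest quantile of order $1-\alpha_m$ of $f(X)$.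
   Context: The depth function is $D(x;P,\mathcal{U})=\inf\{P(U): x\in U\in\mathcal{U}\}$. The center is $C(P,\mathcal{U})=\{x\in\mathbb{R}^d: D(x;P,\mathcal{U})=\alpha_m\}$, the set where $D$ attains its maximum (which exists under the stated assumptions). A function $f:\mathbb{R}^d\to\mathbb{R}$ is a C-function with respect to a family $\mathcal{V}$ of closed subsets of $\mathbb{R}^d$ if for every $t\in\mathbb{R}$ the set $f^{-1}((-\infty,t])$ is either empty or belongs to $\mathcal{V}$. For a real random variable $Y$, the largest quantile of order $1-\alpha$ is $Q_{1-\alpha}=\sup\{t\in\mathbb{R}:\mathrm{Prob}(Y\ge t)\ge\alpha\}$. *)

(* Defs.v *)
From HB Require Import structures.
From mathcomp Require Import all_boot all_order all_algebra.
From mathcomp Require Import all_classical all_reals all_analysis.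

Set Implicit Arguments.
Unset Strict Implicit.
Unset Printing Implicit Defensive.

Import Order.TTheory GRing.Theory Num.Theory.
Import numFieldNormedType.Exports.

Local Open Scope classical_set_scope.
Local Open Scope ring_scope.

(* R^d with its Borel sigma-algebra; it is convertible to 'rV[R]_d. *)
Definition borel_rV (R : realType) (d : nat) :=
  g_sigma_algebraType (@open 'rV[R]_d).

(* The filter of neighbourhoods of infinity, ||x|| -> +oo. The library norm on
   'rV[R]_d is the sup norm; the filter is the same for every norm on R^d. *)
Definition norm_pinfty_nbhs (R : realType) (d : nat) : set_system 'rV[R]_d :=
  filter_from [set: R] (fun M => [set x | M < `|x|]).
Arguments norm_pinfty_nbhs : clear implicits.

Definition depth (R : realType) (d : nat) (P : probability (borel_rV R d) R)
    (UU : set (set 'rV[R]_d)) (x : 'rV[R]_d) : \bar R :=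
  ereal_inf [set P U | U in [set U | UU U /\ U x]].

(* A supremum, which is the maximum exactly when [depth_center] is nonempty. *)
Definition max_depth (R : realType) (d : nat)
    (P : probability (borel_rV R d) R) (UU : set (set 'rV[R]_d)) : \bar R :=
  ereal_sup (range (depth P UU)).

Definition depth_center (R : realType) (d : nat) (P : probability (borel_rV R d) R)
    (UU : set (set 'rV[R]_d)) : set 'rV[R]_d :=
  [set x | depth P UU x = max_depth P UU].

Definition C_function (R : realType) (d : nat) (VV : set (set 'rV[R]_d))
    (f : 'rV[R]_d -> R) : Prop :=
  forall t : R, f @^-1` `]-oo, t] = set0 \/ VV (f @^-1` `]-oo, t]).

(* Q_{1 - alpha}, the largest quantile of order 1 - alpha of Y. The supremum is
   taken in the extended reals, so no convention is needed for an empty or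
   unbounded set. Y is meant to be measurable; this is not part of the type
   since for Y = f o X it follows from f being a C-function. *)
Definition largest_quantile (dsp : measure_display) (T : measurableType dsp)
    (R : realType) (Pr : probability T R) (Y : T -> R) (alpha : \bar R) :
    \bar R :=
  ereal_sup [set t%:E | t in [set t : R | (alpha <= Pr [set w | (t <= Y w)%R])%E]].

(* Main.v *)
Require Import Defs.
From HB Require Import structures.
From mathcomp Require Import all_boot all_order all_algebra.
From mathcomp Require Import all_classical all_reals all_analysis.
From mathcomp Require Import measurable_realfun.
Import Order.TTheory GRing.Theory Num.Theory.
Import numFieldNormedType.Exports.
Local Open Scope classical_set_scope.
Local Open Scope ring_scope.

(** A C-function [f] turns each point [m] and each [t < f m] into a test set for
    the depth at [m]: the open set [f > t] contains [m] and, its complement being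
    a sublevel set of [f], it lies in [UU] unless it is the whole space, which
    has probability one.  Hence the depth of [m] is at most the probability that
    [f X > t] ([C_function_depth_le]), and a fortiori that [f X >= t].  When [m] is in
    the center its depth is the maximal depth, so every [t < f m] belongs to the
    set whose supremum is the quantile, and letting [t] increase to [f m] gives
    the inequality.  Passing from [f X > t] to [f X >= t] uses monotonicity of
    the measure, for which [f] has to be Borel ([C_function_measurable]). *)

(** The rays above each [t] generate the Borel sets of the line, and their
    preimages under [f] are open, being complements of closed sublevel sets. *)
Lemma C_function_measurable (R : realType) (d : nat)
    (VV : set (set 'rV[R]_d)) (f : 'rV[R]_d -> R) :
    (forall V, VV V -> closed V) -> C_function VV f ->
  measurable_fun [set: borel_rV R d] (f : borel_rV R d -> R).
Proof.
move=> VV_closed fC.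
apply: (measurability _ (RGenOInfty.measurableE R)) => _ [_ [t ->] <-].
rewrite setTI.
apply: sub_sigma_algebra.
suff : closed (f @^-1` `]-oo, t]).
  by move/closed_openC; rewrite preimage_setC setCitvl.
have [->|/VV_closed//] := fC t.
exact: closed0.
Qed.

Lemma depth_le (R : realType) (d : nat) (P : probability (borel_rV R d) R)
    (UU : set (set 'rV[R]_d)) (x : 'rV[R]_d) (U : set 'rV[R]_d) :
  UU U -> U x -> (depth P UU x <= P U)%E.
Proof. by move=> UUU Ux; apply: ereal_inf_lbound; exists U. Qed.

(** Some test set must contain [x], for otherwise the depth is the infimum of the
    empty set, namely plus infinity. *)
Lemma depth_le1 (R : realType) (d : nat) (P : probability (borel_rV R d) R)
    (UU : set (set 'rV[R]_d)) (x : 'rV[R]_d) :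
    (forall U, UU U -> open U) -> (exists2 U, UU U & U x) ->
  (depth P UU x <= 1)%E.
Proof.
move=> UU_open [U UUU Ux].
apply: le_trans (depth_le R d P _ _ _ UUU Ux) _.
by apply: probability_le1; apply: sub_sigma_algebra; exact: UU_open.
Qed.

(** The set [f > t] tests the depth at [x] when it is proper; when it is the whole
    space its probability is one. *)
Lemma C_function_depth_le (R : realType) (d : nat)
    (P : probability (borel_rV R d) R) (VV : set (set 'rV[R]_d))
    (f : 'rV[R]_d -> R) (x : 'rV[R]_d) (t : R) :
    (forall V, VV V -> closed V) -> C_function VV f ->
    (exists2 U, [set ~` V | V in VV] U & U x) -> t < f x ->
  (depth P [set ~` V | V in VV] x <= P (f @^-1` `]t, +oo[))%E.
Proof.
move=> VV_closed fC covx tfx.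
have -> : f @^-1` `]t, +oo[ = ~` (f @^-1` `]-oo, t]).
  by rewrite preimage_setC setCitvl.
have [->|VVt] := fC t.
  rewrite setC0 probability_setT; apply: depth_le1 => // _ [V VVV <-].
  exact: closed_openC (VV_closed _ VVV).
apply: depth_le; first by exists (f @^-1` `]-oo, t]).
by rewrite /= in_itv /=; apply/negP; rewrite -ltNge.
Qed.

Theorem theorem7p2 (R : realType) (d : nat)
    (dsp : measure_display) (Omega : measurableType dsp)
    (Pr : probability Omega R)
    (X : {RV Pr >-> borel_rV R d})
    (P : probability (borel_rV R d) R)
    (hP : P = distribution Pr X)
    (VV UU : set (set 'rV[R]_d))
    (hVV : forall V, VV V -> closed V)
    (hUU : UU = [set ~` V | V in VV])
    (hcover : forall x : 'rV[R]_d, exists2 U, UU U & U x)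
    (hpos : exists x : 'rV[R]_d, (0 < depth P UU x)%E)
    (hlim : depth P UU @ norm_pinfty_nbhs R d --> 0%E)
    (f : 'rV[R]_d -> R)
    (hf : C_function VV f) :
  forall m : 'rV[R]_d, depth_center P UU m ->
    ((f m)%:E <= largest_quantile Pr (f \o X) (max_depth P UU))%E.
Proof.
move=> m m_center.
apply/lee_subgt0Pr => e e_gt0.
apply: ereal_sup_ubound; exists (f m - e) => //=.
rewrite -m_center hUU.
have tlt : f m - e < f m by rewrite ltrBlDr ltrDl.
have covm : exists2 U, [set ~` V | V in VV] U & U m by rewrite -hUU.
apply: le_trans (C_function_depth_le R d P VV f m _ hVV hf covm tlt) _.
have f_meas := C_function_measurable R d VV f hVV hf.
have f_preim (A : set R) :
    measurable A -> measurable (f @^-1` A : set (borel_rV R d)).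
  by move=> mA; rewrite -[X in measurable X]setTI; exact: f_meas.
have -> : [set w | f m - e <= (f \o X) w] =
    X @^-1` (f @^-1` `[(f m - e), +oo[).
  by apply/seteqP; split => w /=; rewrite in_itv /= andbT.
rewrite [leRHS](_ : _ = P (f @^-1` `[(f m - e), +oo[)); last by rewrite hP.
apply: le_measure; rewrite ?inE; [exact: f_preim..|].
by apply: preimage_subset => y /=; rewrite !in_itv /= !andbT; exact: ltW.
Qed.
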